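(* Consider either a continuous-time Markov process or a discrete-time Markov chain defined on a standard Borel space $S$, with invariant probability measure $\mu$ and singular-value gap $$\gamma:=\inf_{f\in\operatorname{Dom}(L)\cap L^2_0(\mu)\setminus\{0\}}\frac{\|Lf\|}{\|f\|}$$ (where $L=P-I$ and $\operatorname{Dom}(L)=L^2(\mu)$ in discrete time). Let $\varepsilon\in(0,\frac12)$, and let $t>0$ (an integer in discrete time) be such that $d(t)\le\varepsilon$. Then $$\gamma\ge\frac{1-\sqrt{2\varepsilon}}{t}.$$ In particular, $$\frac{1-\sqrt{2\varepsilon}}{\gamma}\le t_{\mathrm{mix}}(\varepsilon).$$
   Context: $L^2(\mu)$ is the space of complex-valued square-integrable functions with norm $\|\cdot\|$; $L^2_0(\mu)=\{g\in L^2(\mu):\int g\,d\mu=0\}$. In continuous time, $P_t(x,dy)$ are the transition kernels of a time-homogeneous Markov process, $P_tg(x)=\mathbb E_x[g(X_t)]$ is assumed strongly continuous on $L^2(\mu)$, and $L$ is its generator, $Lg=\lim_{t\downarrow0}(P_tg-g)/t$, with $\operatorname{Dom}(L)$ the set of $g\in L^2(\mu)$ for which the limit exists in $L^2(\mu)$. In discrete time, $P$ is the Markov transition kernel, $P_t=P^t$ for nonnegative integers $t$. Total variation distance is $\|\nu-\mu\|_{\mathrm{TV}}=\sup_A|\nu(A)-\mu(A)|$. Define $$d(t):=\sup_{\nu}\|\nu P_t-\mu\|_{\mathrm{TV}}=\sup_{x\in S}\|P_t(x,\cdot)-\mu\|_{\mathrm{TV}}$$ (first supremum over probability measures $\nu$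 on $S$) and $t_{\mathrm{mix}}(\varepsilon):=\inf\{t\ge0:d(t)\le\varepsilon\}$ ($t$ ranging over nonnegative integers in discrete time). Conventions: $\inf\emptyset=+\infty$, $1/0=+\infty$, $1/\infty=0$. *)

(* Defs.v *)
From HB Require Import structures.
From mathcomp Require Import all_boot all_order all_algebra.
From mathcomp Require Import all_classical all_reals all_analysis.
From mathcomp Require Import complex.

Set Implicit Arguments.
Unset Strict Implicit.
Unset Printing Implicit Defensive.

Import Order.TTheory GRing.Theory Num.Theory.
Import numFieldNormedType.Exports.

Local Open Scope classical_set_scope.
Local Open Scope ring_scope.

Definition polish (R : realType) (X : metricType R) : Prop :=
  (forall F : set_system X, ProperFilter F -> cauchy F -> exists x : X, F --> x) /\
  (exists2 D : set X, countable D & dense D).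

Definition standard_borel (R : realType) (d : measure_display)
    (S : measurableType d) : Prop :=
  exists (X : metricType R) (f : S -> X),
    [/\ polish X, bijective f &
        forall A : set S, measurable A <-> <<s @open X >> (f @` A)].

Section complex_L2.
Context (R : realType) (d : measure_display) (S : measurableType d).
Implicit Types (mu : {measure set S -> \bar R}) (f : S -> R[i]).

(* Elements of L^2(mu) are represented by functions; equality in L^2(mu) is
   almost everywhere equality. *)
Definition L2norm mu f : \bar R :=
  ('N[mu]_2%:E[EFin \o @Normc.normc R \o f])%E.

Definition L2 mu : set (S -> R[i]) := [set f |
  [/\ measurable_fun [set: S] (fun x => complex.Re (f x)),
      measurable_fun [set: S] (fun x => complex.Im (f x)) &
      (L2norm mu f < +oo)%E]].

Definition Cintegral mu f : R[i] :=
  Complex (\int[mu]_x complex.Re (f x)) (\int[mu]_x complex.Im (f x)).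

Definition L2_0 mu : set (S -> R[i]) :=
  [set f | L2 mu f /\ Cintegral mu f = 0].

(* For f in L^2(mu) and mu invariant under k, f is k x-integrable for
   mu-almost every x only; Cintegral takes a junk value at the other x. *)
Definition kernel_op (k : S -> {measure set S -> \bar R}) f : S -> R[i] :=
  fun x => Cintegral (k x) f.

(* An operator L on L^2(mu) is given by its graph: [L f g] means that f is in
   Dom(L) and Lf = g almost everywhere. *)
Definition singular_value_gap mu (L : (S -> R[i]) -> (S -> R[i]) -> Prop) : \bar R :=
  ereal_inf [set r | exists f g, [/\ L f g, L2_0 mu f,
    ~ (f = (fun=> 0) %[ae mu]) & r = (L2norm mu g / L2norm mu f)%E]].

End complex_L2.

Section mixing.
Context (R : realType) (d : measure_display) (S : measurableType d).
Local Open Scope ereal_scope.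
Implicit Types (mu nu : probability S R) (k : S -> {measure set S -> \bar R}).

Definition kernel_push nu k : set S -> \bar R := fun A => \int[nu]_x k x A.

Definition invariant_measure mu k : Prop :=
  forall A, measurable A -> kernel_push mu k A = mu A.

Definition tv_dist (m1 m2 : set S -> \bar R) : \bar R :=
  ereal_sup [set `|m1 A - m2 A| | A in measurable].

Definition mix_dist mu k : \bar R :=
  ereal_sup [set tv_dist (kernel_push nu k) mu | nu in [set: probability S R]].

End mixing.

Section continuous_time.
Context (R : realType) (d : measure_display) (S : measurableType d).
Variables (mu : probability S R) (P : R -> R.-pker S ~> S).

(* P is indexed by R, but only nonnegative times are meaningful. *)
Definition markov_transition : Prop :=
  (forall x A, measurable A -> P 0 x A = \d_x A) /\
  (forall s t, 0 <= s -> 0 <= t -> forall x A, measurable A ->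
     P (s + t) x A = kcomp_noparam (P s) (P t) x A).

Definition strongly_continuous : Prop := forall f, L2 mu f ->
  L2norm mu (fun x => kernel_op (P t) f x - f x) @[t --> 0^'+] --> 0%E.

Definition generator (f g : S -> R[i]) : Prop :=
  [/\ L2 mu f, L2 mu g &
      L2norm mu (fun x => real_complex R t^-1 * (kernel_op (P t) f x - f x) - g x)
        @[t --> 0^'+] --> 0%E].

Definition mixing_time (eps : R) : \bar R :=
  ereal_inf [set t%:E | t in [set t : R | 0 <= t /\ (mix_dist mu (P t) <= eps%:E)%E]].

End continuous_time.

Section discrete_time.
Context (R : realType) (d : measure_display) (S : measurableType d).
Variables (mu : probability S R) (P : R.-pker S ~> S).

Fixpoint kernel_pow (n : nat) : R.-spker S ~> S :=
  if n is m.+1 then mkcomp_noparam P (kernel_pow m)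
  else kdirac (@measurable_id _ S setT).

Definition discrete_generator (f g : S -> R[i]) : Prop :=
  [/\ L2 mu f, L2 mu g & g = (fun x => kernel_op P f x - f x) %[ae mu]].

Definition discrete_mixing_time (eps : R) : \bar R :=
  ereal_inf [set n%:R%:E | n in
    [set n : nat | (mix_dist mu (kernel_pow n) <= eps%:E)%E]].

End discrete_time.

(* Main.v *)
Require Import Defs.
From HB Require Import structures.
From mathcomp Require Import all_boot all_order all_algebra.
From mathcomp Require Import all_classical all_reals all_analysis.
From mathcomp Require Import measurable_realfun complex ring lra.

Set Implicit Arguments.
Unset Strict Implicit.
Unset Printing Implicit Defensive.

Import Order.TTheory GRing.Theory Num.Theory.
Import numFieldNormedType.Exports.

Local Open Scope classical_set_scope.
Local Open Scope ring_scope.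

(** Write [s] for the square root of [2 * eps].  If [d(t) <= eps], then [P_t]
    contracts the mean-zero part of [L^2(mu)] by the factor [s]
    ([norm2_kop_mean0]).  On the other hand [P_t f - f] cannot be larger than
    [t] times [L f], because [P_t f - f] is a telescoping sum of [n] terms
    [P_{kh} (P_h f - f)] with [h = t / n], each of norm at most
    [norm (P_h f - f)], and [n * norm (P_h f - f)] tends to [t * norm (L f)]
    ([norm2_iterate_le], [norm2_generator_le]).  The triangle inequality gives
    [(1 - s) * norm f <= t * norm (L f)] ([norm2_le_of_mixing]), and dividing
    by [t * norm f] bounds the gap.  For [t = 0] the same inequality says that
    there is no nonzero [f] at all, so that the gap is infinite and the bound
    on the mixing time holds there too ([gap_ge]).

    The contraction is where mixing enters.  Let [P] be a Markov kernel with
    distance at most [eps] to [mu] in total variation, from every starting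
    point.  For a bounded [g] of mean zero, splitting [g] into its level sets
    gives [sup |P g| <= 2 * eps * sup |g|] ([tv_contraction]).  The adjoint
    [P*] of [P] in [L^2(mu)] does not increase the supremum and preserves the
    mean; it is obtained from a Radon-Nikodym density ([adjoint_exists]).
    Alternating the two operators therefore produces functions
    [g, P g, P* P g, P P* P g, ...] whose squared norms [a_n] satisfy
    [a_2k = O ((2 * eps) ^ (2k))].  By Cauchy-Schwarz,
    [a_(n+1) ^ 2 <= a_n * a_(n+2)], hence the ratios [a_(n+1) / a_n] increase,
    and the first one, [norm (P g) ^ 2 / norm g ^ 2], cannot exceed the growth
    rate [2 * eps] ([log_convex_ratio], [kop_sqr_le_bdd]).  Bounded functions
    of mean zero are dense in [L^2_0(mu)] and [P] is a contraction of
    [L^2(mu)], so the bound extends.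

    All this is done for real functions; a Markov operator acts separately on
    real and imaginary parts, and the squared [L^2] norms of the two parts add
    up ([L2norm_le_of_Re_Im]). *)

(** * Real inequalities *)

(** Counting the levels [1, ..., n] below [y] rounds [y] down to an integer.
    This is the layer-cake formula in discrete form. *)
Lemma level_count (R : realFieldType) (n : nat) (y : R) : 0 <= y <= n%:R ->
  `|y - \sum_(k < n) (k.+1%:R <= y)%R%:R| <= 1.
Proof.
elim: n => [|n IH] /andP[y0 yn].
  by rewrite big_ord0 subr0 ger0_norm// (le_trans yn).
rewrite big_ord_recr/=; have [lt_yn|le_ny] := ltP y n%:R.
  have -> : (n.+1%:R <= y) = false.
    by apply/negbTE; rewrite -ltNge (lt_le_trans lt_yn)// ler_nat.
  by rewrite addr0 IH// y0 ltW.
rewrite (eq_bigr (fun=> 1)); last first.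
  by move=> k _; rewrite (le_trans _ le_ny) ?ler_nat ?ltn_ord.
rewrite sumr_const card_ord; case: (leP n.+1%:R y) => /= h.
  have -> : y = n.+1%:R by apply/eqP; rewrite eq_le yn h.
  by rewrite -natrD addn1 subrr normr0.
by rewrite addr0 ger0_norm ?subr_ge0// lerBlDl -natr1 in yn *.
Qed.

(** Interleaving [x] and [y] gives a log-convex sequence
    [x 0, y 0, x 1, y 1, ...], whose successive ratios increase; a first ratio
    larger than [theta] would force growth faster than [theta ^+ n]. *)
Lemma log_convex_ratio (R : realType) (x y : nat -> R) (D theta : R) :
    0 < theta -> (forall k, 0 <= x k) -> (forall k, 0 <= y k) ->
    (forall k, y k ^+ 2 <= x k * x k.+1) ->
    (forall k, x k.+1 ^+ 2 <= y k * y k.+1) ->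
    (forall k, x k <= D * (theta ^+ 2) ^+ k) ->
  y 0%N <= theta * x 0%N.
Proof.
move=> th0 x0 y0 yx xy xD; have [//|lt_y] := leP.
have xp : 0 < x 0%N.
  rewrite lt_neqAle x0 andbT; apply/negP => /eqP x00.
  have := yx 0%N; rewrite -x00 mul0r => h.
  have : y 0%N ^+ 2 = 0 by apply/eqP; rewrite eq_le h sqr_ge0.
  by move/eqP; rewrite sqrf_eq0 => /eqP y00; rewrite y00 -x00 mulr0 ltxx in lt_y.
pose r := y 0%N / x 0%N.
have rth : theta < r by rewrite ltr_pdivlMr.
have r0 : 0 < r := lt_trans th0 rth.
have step k : 0 < x k /\ r * x k <= y k -> r * y k <= x k.+1 /\ r * x k.+1 <= y k.+1.
  move=> [xk rk]; have yk : 0 < y k by rewrite (lt_le_trans _ rk)// mulr_gt0.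
  have h : r * y k <= x k.+1.
    rewrite -(ler_pM2l xk); apply: le_trans (yx k).
    by rewrite expr2 mulrA ler_pM2r// mulrC.
  split => //; have xk1 : 0 < x k.+1 by rewrite (lt_le_trans _ h)// mulr_gt0.
  rewrite -(ler_pM2l yk); apply: le_trans (xy k).
  by rewrite expr2 mulrA ler_pM2r// mulrC.
have xk k : [/\ 0 < x k, r * x k <= y k & x 0%N * (r ^+ 2) ^+ k <= x k].
  elim: k => [|k [xk rk gk]]; first by rewrite expr0 mulr1 /r divfK ?gt_eqF.
  have [h1 h2] := step _ (conj xk rk); split => //.
    by rewrite (lt_le_trans _ h1)// mulr_gt0// (lt_le_trans _ rk)// mulr_gt0.
  apply: le_trans h1; apply: (@le_trans _ _ (r * (r * x k))); last by rewrite ler_pM2l.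
  by rewrite exprSr mulrA [r * (r * _)]mulrA -expr2 mulrC ler_pM2l// exprn_gt0.
pose q := (r / theta) ^+ 2.
have q1 : 1 < q by rewrite exprn_egt1// ltr_pdivlMr// mul1r.
have qb k : q ^+ k <= D / x 0%N.
  have [_ _ gk] := xk k; have gD := le_trans gk (xD k).
  have -> : q ^+ k = (r ^+ 2) ^+ k / (theta ^+ 2) ^+ k.
    by rewrite /q (expr_div_n r) expr_div_n.
  by rewrite ler_pdivlMr// mulrAC ler_pdivrMr ?exprn_gt0// mulrC.
have h1 : 0 < q - 1 by rewrite subr_gt0.
have [k hk] : exists k, D / x 0%N < 1 + (q - 1) * k%:R.
  pose z := D / x 0%N / (q - 1); exists (Num.bound `|z|).
  have := archi_boundP (normr_ge0 z); move/(le_lt_trans (ler_norm z)).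
  by rewrite ltr_pdivrMr// => /lt_trans; apply; rewrite mulrC ltrDr.
have : 1 + (q - 1) * k%:R <= q ^+ k.
  elim: k {hk} => [|k IH]; first by rewrite mulr0 addr0 expr0.
  rewrite exprS; have : q * (1 + (q - 1) * k%:R) <= q * q ^+ k.
    by rewrite ler_pM2l// (lt_trans ltr01).
  apply: le_trans; rewrite -natr1.
  by have := mulr_ge0 (sqr_ge0 (q - 1)) (ler0n R k); lra.
by move/(lt_le_trans hk)/lt_le_trans => /(_ _ (qb k)); rewrite ltxx.
Qed.

(** * Functionals on bounded functions *)

Section bounded_functionals.
Context (R : realType) (d : measure_display) (S : measurableType d).
Implicit Types (c : R) (f g h : S -> R).

Definition bdd_by c f : Prop :=
  measurable_fun [set: S] f /\ forall x, `|f x| <= c.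

Lemma bdd_by_indic A : measurable A -> bdd_by 1 \1_A.
Proof.
move=> mA; split; first exact: measurable_indic.
by move=> x; rewrite indicE; case: (_ \in _); rewrite ?normr0 ?normr1.
Qed.

Lemma bdd_by_cst (a : R) : bdd_by `|a| (cst a).
Proof. by split. Qed.

Lemma bdd_byD c1 c2 f g : bdd_by c1 f -> bdd_by c2 g ->
  bdd_by (c1 + c2) (fun x => f x + g x).
Proof.
move=> [mf fc] [mg gc]; split; first exact: measurable_funD.
by move=> x; rewrite (le_trans (ler_normD _ _))// lerD.
Qed.

Lemma bdd_byZ a c f : bdd_by c f -> bdd_by (`|a| * c) (fun x => a * f x).
Proof.
move=> [mf fc]; split; first exact: measurable_funM.
by move=> x; rewrite normrM ler_wpM2l.
Qed.

Lemma bdd_byB c1 c2 f g : bdd_by c1 f -> bdd_by c2 g ->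
  bdd_by (c1 + c2) (fun x => f x - g x).
Proof.
move=> [mf fc] [mg gc]; split; first exact: measurable_funB.
by move=> x; rewrite (le_trans (ler_normB _ _))// lerD.
Qed.

Lemma bdd_byM c1 c2 f g : bdd_by c1 f -> bdd_by c2 g ->
  bdd_by (c1 * c2) (fun x => f x * g x).
Proof.
move=> [mf fc] [mg gc]; split; first exact: measurable_funM.
by move=> x; rewrite normrM ler_pM.
Qed.

(** A bounded [h] is, up to a small uniform error, a constant plus a sum of
    indicators of its level sets [{h >= - c + (k + 1) * del}] weighted by equal
    steps [del] whose total is the oscillation [2 * c].  A functional that kills
    constants and is at most [e] on indicators is thus at most [2 * c * e] at
    [h].  With [e = 0] this is a uniqueness principle: two continuous functionals
    that agree on indicators agree on all bounded functions. *)
Lemma bdd_by_functional (Phi : (S -> R) -> R) (B e : R) :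
    (forall c1 c2 f g, bdd_by c1 f -> bdd_by c2 g ->
      Phi (fun x => f x + g x) = Phi f + Phi g) ->
    (forall a c f, bdd_by c f -> Phi (fun x => a * f x) = a * Phi f) ->
    (forall c f, bdd_by c f -> `|Phi f| <= B * c) ->
    Phi (cst 1) = 0 ->
    (forall A, measurable A -> `|Phi \1_A| <= e) ->
  forall c h, 0 <= c -> bdd_by c h -> `|Phi h| <= 2 * c * e.
Proof.
move=> PhiD PhiZ PhiB Phi1 Phie c h; rewrite le_eqVlt => /predU1P[<-|c0] hc.
  by rewrite mulr0 mul0r -(mulr0 B) PhiB.
have B0 : 0 <= B.
  have := PhiB _ _ (bdd_by_cst 1); rewrite normr1 mulr1.
  by apply: le_trans; exact: normr_ge0.
(* The first term bounds the contribution of the rounding error. *)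
have key n : `|Phi h| <= B * (2 * c / n.+1%:R) + 2 * c * e.
  pose del := 2 * c / n.+1%:R.
  have del0 : 0 < del by rewrite divr_gt0// mulr_gt0.
  pose A (k : nat) := h @^-1` `[- c + k.+1%:R * del, +oo[.
  have mA k : measurable (A k).
    by rewrite -[A k]setTI; exact: hc.1.
  pose s m x := \sum_(k < m) del * \1_(A k) x.
  have sS m : s m.+1 = (fun x => s m x + del * \1_(A m) x).
    by apply/funext => x; rewrite /s big_ord_recr.
  have s0 : s 0%N = (fun x => 0 * cst 1 x).
    by apply/funext => x; rewrite /s big_ord0 mul0r.
  have sb m : exists C, bdd_by C (s m).
    elim: m => [|m [C IH]].
      by exists (`|0 : R| * `|1 : R|); rewrite s0; apply: bdd_byZ; exact: bdd_by_cst.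
    exists (C + `|del| * 1); rewrite sS; apply: bdd_byD => //.
    by apply: bdd_byZ; exact: bdd_by_indic.
  have Phis m : `|Phi (s m)| <= m%:R * (del * e).
    elim: m => [|m IH].
      by rewrite s0 (PhiZ _ _ _ (bdd_by_cst 1)) !mul0r normr0.
    have [C sC] := sb m.
    rewrite sS (PhiD _ _ _ _ sC (bdd_byZ del (bdd_by_indic (mA m)))).
    rewrite (PhiZ _ _ _ (bdd_by_indic (mA m))).
    rewrite (le_trans (ler_normD _ _))// -natr1 mulrDl mul1r lerD//.
    by rewrite normrM gtr0_norm// ler_pM2l// Phie.
  (* The constant shifts [h] into the range [0, 2 * c] of the levels. *)
  pose r x := h x + c * cst 1 x - s n.+1 x.
  have rdel : bdd_by del r.
    split.
      have [C [ms _]] := sb n.+1.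
      apply: measurable_funB => //; apply: measurable_funD; first exact: hc.1.
      exact: measurable_funM.
    move=> x; pose y := (h x + c) / del.
    have /(level_count (n := n.+1)) : 0 <= y <= n.+1%:R.
      have /ler_normlP[hc1 hc2] := hc.2 x.
      apply/andP; split; first by rewrite divr_ge0 ?(ltW del0)//; lra.
      by rewrite ler_pdivrMr// /del mulrCA divff// mulr1; lra.
    rewrite -(ler_pM2l del0) mulr1; apply: le_trans.
    rewrite -{1}(gtr0_norm del0) -normrM mulrBr /y [del * (_ / _)]mulrC.
    rewrite divfK ?gt_eqF// /r mulr1 /s mulr_sumr.
    rewrite le_eqVlt; apply/orP; left.
    apply/eqP; congr `|_ - _|; apply: eq_bigr => k _.
    rewrite indicE; congr (_ * (nat_of_bool _)%:R).
    rewrite ler_pdivlMr//; apply/idP/idP; rewrite inE /A/= in_itv/= andbT; lra.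
  have hE : h = (fun x => (r x + s n.+1 x) + (- c) * cst 1 x).
    by apply/funext => x; rewrite /r/= subrK mulr1 mulr1 addrK.
  have [C sC] := sb n.+1.
  rewrite hE (PhiD _ _ _ _ (bdd_byD rdel sC) (bdd_byZ (- c) (bdd_by_cst 1))).
  rewrite (PhiZ _ _ _ (bdd_by_cst 1)) Phi1 mulr0 addr0 (PhiD _ _ _ _ rdel sC).
  rewrite (le_trans (ler_normD _ _))// lerD ?PhiB//.
  by rewrite (le_trans (Phis _))// /del mulrA mulrCA mulfV// mulr1.
apply/ler_addgt0Pr => eta eta0.
pose z := B * (2 * c) / eta; pose n := Num.bound z.
apply: le_trans (key n) _; rewrite addrC lerD2l mulrA ler_pdivrMr//.
rewrite [eta * _]mulrC -ler_pdivrMr// -/z ltW//.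
have zn : z < n%:R.
  apply: archi_boundP.
  by rewrite /z divr_ge0 ?(ltW eta0)// mulr_ge0// mulr_ge0// ltW.
by rewrite (lt_trans zn)// ltr_nat.
Qed.
End bounded_functionals.

Arguments bdd_by_cst {R d S} a.

(** * Markov operators on bounded functions *)

Section finite_integrals.
Context (R : realType) (d : measure_display) (S : measurableType d).
Implicit Types (m : {measure set S -> \bar R}) (f g : S -> R).

Lemma bdd_by_integrable m c f : (m [set: S] < +oo)%E -> bdd_by c f ->
  m.-integrable [set: S] (EFin \o f).
Proof.
move=> mS [mf fc]; apply: measurable_bounded_integrable => //.
exists c; split; first exact: num_real.
by move=> M cM x _; rewrite /= (le_trans (fc x))// ltW.
Qed.

Lemma Rintegral_indic m A : measurable A -> \int[m]_x \1_A x = fine (m A).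
Proof. by move=> mA; rewrite /Rintegral integral_indic// setIT. Qed.

Lemma Rintegral_bdd_by m c f : m [set: S] = 1%E -> bdd_by c f ->
  `|\int[m]_x f x| <= c.
Proof.
move=> m1 fc; have m1y : (m [set: S] < +oo)%E by rewrite m1 ltry.
apply: (le_trans (le_normr_Rintegral measurableT (bdd_by_integrable m1y fc))).
have -> : c = \int[m]_x (cst c x) by rewrite Rintegral_cst// m1 mulr1.
apply: le_Rintegral => //.
- by apply: integrable_norm; exact: bdd_by_integrable _ fc.
- exact: bdd_by_integrable _ (bdd_by_cst c).
- by move=> x _; exact: fc.2.
Qed.

Lemma discriminant_le (a b c : R) : 0 <= c ->
  (forall t, 0 <= a + 2 * t * b + t ^+ 2 * c) -> b ^+ 2 <= a * c.
Proof.
rewrite le_eqVlt => /predU1P[<- h|c0 h].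
  rewrite mulr0; have [->|b0] := eqVneq b 0; first by rewrite expr0n.
  have := h (- (a + 1) / (2 * b)).
  have -> : a + 2 * (- (a + 1) / (2 * b)) * b + (- (a + 1) / (2 * b)) ^+ 2 * 0 = -1.
    by field.
  by rewrite lerNr oppr0 ler10.
have := h (- b / c).
have -> : a + 2 * (- b / c) * b + (- b / c) ^+ 2 * c = (a * c - b ^+ 2) / c.
  by field; rewrite gt_eqF.
by rewrite pmulr_lge0 ?invr_gt0// subr_ge0.
Qed.

Lemma cauchy_schwarz_bdd m c1 c2 f g : (m [set: S] < +oo)%E ->
    bdd_by c1 f -> bdd_by c2 g ->
  (\int[m]_x (f x * g x)) ^+ 2 <=
    (\int[m]_x (f x * f x)) * \int[m]_x (g x * g x).
Proof.
move=> my fb gb; apply: discriminant_le.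
  by apply: Rintegral_ge0 => x _; rewrite -expr2 sqr_ge0.
move=> t.
have iff := bdd_by_integrable my (bdd_byM fb fb).
have ifg := bdd_by_integrable my (bdd_byZ (2 * t) (bdd_byM fb gb)).
have igg := bdd_by_integrable my (bdd_byZ (t ^+ 2) (bdd_byM gb gb)).
have ifg' := bdd_by_integrable my (bdd_byM fb gb).
have igg' := bdd_by_integrable my (bdd_byM gb gb).
rewrite -!RintegralZl// -!RintegralD//; last first.
  exact: (bdd_by_integrable my
    (bdd_byD (bdd_byM fb fb) (bdd_byZ (2 * t) (bdd_byM fb gb)))).
apply: Rintegral_ge0 => x _.
by have := sqr_ge0 (f x + t * g x); lra.
Qed.

End finite_integrals.

Section kernel_operator.
Context (R : realType) (d : measure_display) (S : measurableType d).
Implicit Types (f g : S -> R).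

(** The operator of the kernel on real functions; the value at [x] is
    meaningful when [f] is integrable for [K x]. *)
Definition kop (K : S -> {measure set S -> \bar R}) f : S -> R :=
  fun x => \int[K x]_y f y.

Lemma measurable_kop (K : R.-spker S ~> S) f :
  measurable_fun [set: S] f -> measurable_fun [set: S] (kop K f).
Proof.
move=> mf; apply: (@measurableT_comp _ _ _ _ _ _ fine) => //.
have mE : measurable_fun [set: S] (EFin \o f) by exact/measurable_EFinP.
under eq_fun do rewrite integralE.
apply: emeasurable_funB; apply: measurable_fun_integral_kernel => //.
- exact: measurable_kernel.
- exact: measurable_funepos.
- exact: measurable_kernel.
- exact: measurable_funeneg.
Qed.

End kernel_operator.

Section markov_kernel_bounded.
Context (R : realType) (d : measure_display) (S : measurableType d).
Variables (mu : probability S R) (K : R.-spker S ~> S).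
Hypothesis K1 : forall x, K x [set: S] = 1%E.
Hypothesis muK : invariant_measure mu K.
Implicit Types (f g h v w : S -> R).

Let Ky x : (K x [set: S] < +oo)%E. Proof. by rewrite K1 ltry. Qed.
Let muy : (mu [set: S] < +oo)%E. Proof. by rewrite probability_setT ltry. Qed.

Lemma bdd_by_kop c f : bdd_by c f -> bdd_by c (kop K f).
Proof.
move=> fc; split; first exact: measurable_kop fc.1.
by move=> x; exact: Rintegral_bdd_by.
Qed.

Lemma kopD c1 c2 f g : bdd_by c1 f -> bdd_by c2 g ->
  kop K (fun x => f x + g x) = (fun x => kop K f x + kop K g x).
Proof.
move=> fc gc; apply/funext => x; rewrite /kop RintegralD//.
  exact: bdd_by_integrable _ fc.
exact: bdd_by_integrable _ gc.
Qed.

Lemma kopZ a c f : bdd_by c f ->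
  kop K (fun x => a * f x) = (fun x => a * kop K f x).
Proof.
move=> fc; apply/funext => x; rewrite /kop RintegralZl//.
exact: bdd_by_integrable _ fc.
Qed.

Lemma kop1 : kop K (cst 1) = cst 1.
Proof. by apply/funext => x; rewrite /kop Rintegral_cst// K1 mulr1. Qed.

Lemma kop_indic A : measurable A -> kop K \1_A = (fun x => fine (K x A)).
Proof. by move=> mA; apply/funext => x; rewrite /kop Rintegral_indic. Qed.

Lemma kernel_fin_num x A : measurable A -> K x A \is a fin_num.
Proof.
move=> mA; rewrite ge0_fin_numE// (le_lt_trans _ (Ky x))//.
by rewrite le_measure// ?inE.
Qed.

(** Both sides are continuous linear functionals of [h] that agree on
    indicators, by invariance. *)
Lemma Rintegral_kop c h : 0 <= c -> bdd_by c h ->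
  \int[mu]_x kop K h x = \int[mu]_x h x.
Proof.
move=> c0 hc; apply/eqP; rewrite -subr_eq0 -normr_le0 -(mulr0 (2 * c)).
pose Phi f := \int[mu]_x kop K f x - \int[mu]_x f x.
have I b f : bdd_by b f -> mu.-integrable [set: S] (EFin \o f).
  exact: bdd_by_integrable.
apply: (bdd_by_functional (Phi := Phi) (B := 2)) c0 hc.
- move=> c1 c2 f g fb gb; rewrite /Phi (kopD fb gb) !RintegralD//.
  + by rewrite addrACA opprD.
  + exact: I fb.
  + exact: I gb.
  + exact: I (bdd_by_kop fb).
  + exact: I (bdd_by_kop gb).
- move=> a b f fb; rewrite /Phi (kopZ a fb) !RintegralZl ?mulrBr//.
  + exact: I fb.
  + exact: I (bdd_by_kop fb).
- move=> b f fb; rewrite mulrDl mul1r (le_trans (ler_normB _ _))// lerD//.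
    by apply: Rintegral_bdd_by; [exact: probability_setT|exact: bdd_by_kop].
  by apply: Rintegral_bdd_by fb; exact: probability_setT.
- by rewrite /Phi kop1 subrr.
- move=> A mA; rewrite /Phi kop_indic// Rintegral_indic// /Rintegral.
  under eq_integral => x _ do rewrite fineK ?kernel_fin_num//.
  have := muK mA; rewrite /kernel_push => ->.
  by rewrite subrr normr0.
Qed.

(** The starting distribution [\d_x] shows that [K x A] and [mu A] differ by at
    most [eps] for every [A]; the functional [h |-> K h x - mu h] is then
    estimated through level sets.  The factor [2 * c] is the oscillation of [h]. *)
Lemma tv_contraction eps c h : (mix_dist mu K <= eps%:E)%E ->
    0 <= c -> bdd_by c h -> \int[mu]_x h x = 0 ->
  bdd_by (2 * c * eps) (kop K h).
Proof.
move=> mix c0 hc h0; split; first exact: measurable_kop hc.1.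
move=> x; pose Phi f := kop K f x - \int[mu]_y f y.
have -> : kop K h x = Phi h by rewrite /Phi h0 subr0.
have I b f : bdd_by b f -> mu.-integrable [set: S] (EFin \o f).
  exact: bdd_by_integrable.
apply: (bdd_by_functional (Phi := Phi) (B := 2)) c0 hc.
- move=> c1 c2 f g fb gb; rewrite /Phi (kopD fb gb) RintegralD//.
  + by rewrite addrACA opprD.
  + exact: I fb.
  + exact: I gb.
- move=> a b f fb; rewrite /Phi (kopZ a fb) RintegralZl ?mulrBr//.
  exact: I fb.
- move=> b f fb; rewrite mulrDl mul1r (le_trans (ler_normB _ _))// lerD//.
    by rewrite (bdd_by_kop fb).2.
  by apply: Rintegral_bdd_by fb; exact: probability_setT.
- rewrite /Phi kop1 Rintegral_cst// [X in fine X](_ : _ = 1%E) ?mulr1 ?subrr//.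
  exact: probability_setT.
- move=> A mA; rewrite /Phi kop_indic// Rintegral_indic//.
  rewrite -lee_fin; apply: le_trans mix.
  apply: (@le_trans _ _ (tv_dist (kernel_push (\d_x : probability S R) K) mu)); last first.
    by apply: ereal_sup_ubound; exists (\d_x : probability S R).
  apply: ereal_sup_ubound; exists A => //.
  rewrite /kernel_push integral_dirac ?diracT ?mul1e//; last first.
    exact: measurable_kernel.
  rewrite -[in LHS](fineK (kernel_fin_num x mA)).
  by rewrite -[in LHS](fineK (fin_num_measure mu A mA)).
Qed.

End markov_kernel_bounded.

(** * The adjoint of a Markov operator *)

Section weighted_push.
Context (R : realType) (d : measure_display) (S : measurableType d).
Variables (mu : probability S R) (K : R.-spker S ~> S) (C : R) (f : S -> R).
Hypothesis muK : invariant_measure mu K.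
Hypothesis C0 : 0 <= C.
Hypothesis mf : measurable_fun [set: S] f.
Hypothesis f_bounds : forall x, 0 <= f x <= C.
Local Open Scope ereal_scope.

(** For [f] a density with respect to [mu], this is the law after one step of
    the chain started from [f . mu]. *)
Definition weighted_push (A : set S) : \bar R := \int[mu]_x ((f x)%:E * K x A).

Let wf x : 0 <= (f x)%:E.
Proof. by rewrite lee_fin; have /andP[] := f_bounds x. Qed.

Let mfE : measurable_fun [set: S] (EFin \o f).
Proof. exact/measurable_EFinP. Qed.

Let mw A : measurable A -> measurable_fun [set: S] (fun x => (f x)%:E * K x A).
Proof. by move=> mA; apply: emeasurable_funM => //; exact: measurable_kernel. Qed.

Let weighted_push0 : weighted_push set0 = 0.
Proof. by apply: integral0_eq => x _; rewrite measure0 mule0. Qed.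

Let weighted_push_ge0 A : 0 <= weighted_push A.
Proof. by apply: integral_ge0 => x _; exact: mule_ge0. Qed.

Let weighted_push_sigma_additive : semi_sigma_additive weighted_push.
Proof.
move=> F mF tF mUF; rewrite [X in _ --> X](_ : _ =
  \int[mu]_x (\sum_(n <oo) ((f x)%:E * K x (F n)))); last first.
  apply: eq_integral => x _; rewrite nneseriesZl//.
  by congr (_ * _); apply/esym/cvg_lim => //; exact/measure_semi_sigma_additive.
apply/cvg_closeP; split.
  by apply: is_cvg_nneseries => n _ _; exact: weighted_push_ge0.
rewrite closeE// integral_nneseries//; first by move=> n; exact: mw.
by move=> n x _; exact: mule_ge0.
Qed.

HB.instance Definition _ := isMeasure.Build _ _ R weighted_push
  weighted_push0 weighted_push_ge0 weighted_push_sigma_additive.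

Lemma weighted_push_le A : measurable A -> weighted_push A <= C%:E * mu A.
Proof.
move=> mA; rewrite -(muK mA) /kernel_push -ge0_integralZl//;
  last exact: measurable_kernel.
apply: ge0_le_integral => //.
- by move=> x _; exact: mule_ge0.
- exact: mw.
- by apply: emeasurable_funM => //; exact: measurable_kernel.
- by move=> x _; rewrite lee_wpmul2r// lee_fin; have /andP[] := f_bounds x.
Qed.

Let weighted_push_fin : fin_num_fun weighted_push.
Proof.
move=> A mA; rewrite ge0_fin_numE// (le_lt_trans (weighted_push_le mA))//.
by rewrite ltey_eq fin_numM// fin_num_measure.
Qed.

HB.instance Definition _ := @Measure_isFinite.Build _ _ R weighted_push
  weighted_push_fin.

(** The measure is at most [C * mu] by invariance of [mu], hence it has a
    density, and the density is at most [C] almost everywhere. *)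
Lemma weighted_push_density : exists rho : S -> R,
  [/\ measurable_fun [set: S] rho, forall x, (0 <= rho x <= C)%R &
      forall A, measurable A -> weighted_push A = \int[mu]_(x in A) (rho x)%:E].
Proof.
have wmu : weighted_push `<< mu.
  apply/null_content_dominatesP => A mA A0; apply/eqP.
  by rewrite eq_le weighted_push_ge0 andbT (le_trans (weighted_push_le mA))// A0 mule0.
have [g [g0 gfin ig gE]] := @radon_nikodym_sigma_finite _ _ R mu weighted_push wmu.
have mg : measurable_fun [set: S] g := measurable_int mu ig.
(* The density exceeds [C] on a null set only; it is cut off there so that
   the bound holds everywhere. *)
pose N := [set x | C%:E < g x].
have mN : measurable N by rewrite -[N]setTI; exact: emeasurable_fun_o_infty.
have gC : {ae mu, forall x, g x <= C%:E}.
  have mgC : measurable_fun N (fun x => g x - C%:E).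
    by apply: emeasurable_funB => //; exact: measurable_funTS.
  have : ae_eq mu N (fun x => g x - C%:E) (cst 0).
    apply/ae_eq_integral_abs => //.
    rewrite (eq_integral (fun x => g x - C%:E)); last first.
      by move=> x /[!inE] Nx; rewrite gee0_abs// sube_ge0 ?ltW// gfin orbT.
    apply/eqP; rewrite eq_le; apply/andP; split; last first.
      by apply: integral_ge0 => x Nx; rewrite sube_ge0 ?ltW// gfin orbT.
    rewrite integralB//; [|exact: integrableS ig|]; last first.
      exact: finite_measure_integrable_cst.
    by rewrite -gE// integral_cst// sube_le0; exact: weighted_push_le.
  apply: filterS => x h; rewrite leNgt; apply/negP => Nx.
  by have /eqP := h Nx; rewrite sube_eq ?gfin// ?add0e; rewrite ?gt_eqF.
pose rho x := Num.min (fine (g x)) C.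
have mrho : measurable_fun [set: S] rho.
  apply: measurable_minr => //; exact: measurableT_comp.
exists rho; split => // [x|A mA].
  by rewrite /rho le_min fine_ge0// C0 ge_min lexx orbT.
rewrite gE//; apply: ae_eq_integral => //; first exact: measurable_funTS.
  by apply/measurable_EFinP; exact: measurable_funTS.
apply: filterS gC => x gx _; rewrite /rho min_l ?fineK//.
by rewrite -lee_fin fineK.
Qed.

End weighted_push.

Section adjoint.
Context (R : realType) (d : measure_display) (S : measurableType d).
Variables (mu : probability S R) (K : R.-spker S ~> S).
Hypothesis K1 : forall x, K x [set: S] = 1%E.
Hypothesis muK : invariant_measure mu K.
Implicit Types (f g h v w : S -> R).

Let muy : (mu [set: S] < +oo)%E. Proof. by rewrite probability_setT ltry. Qed.

Let I b f : bdd_by b f -> mu.-integrable [set: S] (EFin \o f).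
Proof. exact: bdd_by_integrable. Qed.

(** The function [w] is the adjoint of [K] applied to [v].  Shifting [v] by [c]
    makes it nonnegative; the density of the pushed-forward measure, shifted
    back, represents the functional [h |-> mu (K h * v)] on indicators, hence on
    bounded functions. *)
Lemma adjoint_exists c v : 0 <= c -> bdd_by c v ->
  exists2 w, bdd_by c w &
    forall b h, 0 <= b -> bdd_by b h ->
      \int[mu]_x (h x * w x) = \int[mu]_x (kop K h x * v x).
Proof.
move=> c0 vc; pose f x := v x + c.
have mf : measurable_fun [set: S] f by apply: measurable_funD => //; exact: vc.1.
have f_bounds x : 0 <= f x <= 2 * c.
  by have /ler_normlP[? ?] := vc.2 x; rewrite /f; apply/andP; split; lra.
have [|rho [mrho rhoC rhoE]] := weighted_push_density muK _ mf f_bounds.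
  by rewrite mulr_ge0.
pose w x := rho x - c.
have wc : bdd_by c w.
  split; first exact: measurable_funB.
  by move=> x; have /andP[? ?] := rhoC x; apply/ler_normlP; rewrite /w; split; lra.
exists w => // b h b0 hb; apply/eqP; rewrite -subr_eq0 -normr_le0 -(mulr0 (2 * b)).
pose Phi h := \int[mu]_x (h x * w x) - \int[mu]_x (kop K h x * v x).
have key A : measurable A -> Phi \1_A = 0.
  move=> mA; have Ab := @bdd_by_indic R _ S A mA.
  have Kb := bdd_by_kop K1 Ab; have kE := @kop_indic R _ S K A mA.
  have rhob : bdd_by (2 * c) rho.
    by split => // x; have /andP[r0 r1] := rhoC x; rewrite ger0_norm.
  have fb : bdd_by (2 * c) f.
    by split => // x; have /andP[r0 r1] := f_bounds x; rewrite ger0_norm.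
  have cb : bdd_by `|c| (cst c : S -> R) := bdd_by_cst c.
  have rhoA : \int[mu]_x (\1_A x * rho x) = \int[mu]_x (kop K \1_A x * f x).
    transitivity (fine (weighted_push mu K f A)).
      rewrite rhoE// -[RHS]/(\int[mu]_(x in A) rho x) [RHS]Rintegral_mkcond.
      apply: eq_Rintegral => x _; rewrite patchE indicE.
      by case: (_ \in _); rewrite ?mul1r ?mul0r.
    congr fine; apply: eq_integral => x _.
    by rewrite kE EFinM fineK ?kernel_fin_num// muleC.
  have massA : \int[mu]_x (\1_A x * cst c x) = \int[mu]_x (kop K \1_A x * cst c x).
    rewrite !RintegralZr ?(Rintegral_kop K1 muK ler01 Ab)//.
      exact: I Kb.
    exact: I Ab.
  have split1 : \int[mu]_x (\1_A x * w x) =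
      \int[mu]_x (\1_A x * rho x) - \int[mu]_x (\1_A x * cst c x).
    rewrite -RintegralB//; first by apply: eq_Rintegral => x _; rewrite mulrBr.
      exact: I (bdd_byM Ab rhob).
    exact: I (bdd_byM Ab cb).
  have split2 : \int[mu]_x (kop K \1_A x * v x) =
      \int[mu]_x (kop K \1_A x * f x) - \int[mu]_x (kop K \1_A x * cst c x).
    rewrite -RintegralB//.
    - by apply: eq_Rintegral => x _; rewrite -mulrBr /f addrK.
    - exact: I (bdd_byM Kb fb).
    - exact: I (bdd_byM Kb cb).
  by rewrite /Phi split1 split2 rhoA massA subrr.
apply: (bdd_by_functional (Phi := Phi) (B := 2 * c)) b0 hb.
- move=> c1 c2 g1 g2 g1b g2b; rewrite /Phi (kopD K1 g1b g2b).
  under eq_Rintegral do rewrite mulrDl.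
  under [X in _ - X]eq_Rintegral do rewrite mulrDl.
  rewrite !RintegralD//.
  + by rewrite addrACA opprD.
  + exact: I (bdd_byM (bdd_by_kop K1 g1b) vc).
  + exact: I (bdd_byM (bdd_by_kop K1 g2b) vc).
  + exact: I (bdd_byM g1b wc).
  + exact: I (bdd_byM g2b wc).
- move=> a c1 g gb; rewrite /Phi (kopZ K1 a gb).
  under eq_Rintegral do rewrite -mulrA.
  under [X in _ - X]eq_Rintegral do rewrite -mulrA.
  rewrite !RintegralZl ?mulrBr//.
  + exact: I (bdd_byM (bdd_by_kop K1 gb) vc).
  + exact: I (bdd_byM gb wc).
- move=> b1 g gb; rewrite (_ : 2 * c * b1 = b1 * c + b1 * c); last by ring.
  rewrite (le_trans (ler_normB _ _))//.
  apply: lerD; apply: Rintegral_bdd_by; try exact: probability_setT.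
    exact: bdd_byM gb wc.
  exact: (bdd_byM (bdd_by_kop K1 gb) vc).
- rewrite (_ : cst 1 = \1_[set: S]) ?key//.
  by apply/funext => x; rewrite indicE in_setT.
- by move=> A mA; rewrite key// normr0.
Qed.

End adjoint.

(** * Contraction of bounded centred functions *)

Section bounded_gap.
Context (R : realType) (d : measure_display) (S : measurableType d).
Variables (mu : probability S R) (K : R.-spker S ~> S).
Hypothesis K1 : forall x, K x [set: S] = 1%E.
Hypothesis muK : invariant_measure mu K.

Let muy : (mu [set: S] < +oo)%E. Proof. by rewrite probability_setT ltry. Qed.

(** The spectral bound for bounded functions, by log-convexity along the
    orbit of [g] under the operator and its adjoint in alternation. *)
Lemma kop_sqr_le_bdd eps c g : 0 < eps -> (mix_dist mu K <= eps%:E)%E ->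
    0 <= c -> bdd_by c g -> \int[mu]_x g x = 0 ->
  \int[mu]_x (kop K g x * kop K g x) <= 2 * eps * \int[mu]_x (g x * g x).
Proof.
move=> eps0 mix c0 gc g0; pose theta := 2 * eps.
have th0 : 0 < theta by rewrite mulr_gt0.
pose ck k := theta ^+ k * c.
have ck0 k : 0 <= ck k by rewrite mulr_ge0// exprn_ge0// ltW.
pose P k e := bdd_by (ck k) e /\ \int[mu]_x e x = 0.
pose step (e e' : S -> R) := forall b h, 0 <= b -> bdd_by b h ->
  \int[mu]_x (h x * e' x) = \int[mu]_x (kop K h x * kop K e x).
have contr k e : P k e -> bdd_by (ck k.+1) (kop K e).
  move=> [ec e0]; have -> : ck k.+1 = 2 * ck k * eps.
    by rewrite /ck /theta exprS; ring.
  exact: (tv_contraction K1 mix (ck0 k) ec e0).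
have ex k e : P k e -> exists e', P k.+1 e' /\ step e e'.
  move=> Pe; have [w wc wE] := adjoint_exists K1 muK (ck0 k.+1) (contr _ _ Pe).
  exists w; split => //; split => //.
  have e0 : \int[mu]_x kop K e x = 0.
    by rewrite (Rintegral_kop K1 muK (ck0 k) Pe.1); case: Pe.
  rewrite -e0; have := wE _ _ ler01 (@bdd_by_indic R _ S _ measurableT).
  rewrite indicT (kop1 K1) => w1.
  transitivity (\int[mu]_x (cst 1 x * w x)).
    by apply: eq_Rintegral => x _; rewrite mul1r.
  by rewrite w1; apply: eq_Rintegral => x _; rewrite mul1r.
(* The orbit of [g] under [e |-> K* (K e)]; each step is a choice of an
   adjoint function, defined up to a null set. *)
pose next k e := xget e [set e' | P k.+1 e' /\ step e e'].
pose E := fix E k := if k is j.+1 then next j (E j) else g.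
have PE k : P k (E k).
  elim: k => [|k IH]; first by split => //; rewrite /ck expr0 mul1r.
  by have := xgetPex (E k) (ex _ _ IH) => -[].
have stepE k : step (E k) (E k.+1).
  by have := xgetPex (E k) (ex _ _ (PE k)) => -[].
apply: (@log_convex_ratio R (fun k => \int[mu]_x (E k x * E k x))
  (fun k => \int[mu]_x (kop K (E k) x * kop K (E k) x)) (c ^+ 2)) => //.
- by move=> k; apply: Rintegral_ge0 => x _; rewrite -expr2 sqr_ge0.
- by move=> k; apply: Rintegral_ge0 => x _; rewrite -expr2 sqr_ge0.
- move=> k; rewrite -(stepE k _ _ (ck0 k) (PE k).1).
  exact: cauchy_schwarz_bdd (PE k).1 (PE k.+1).1.
- move=> k; rewrite (stepE k _ _ (ck0 k.+1) (PE k.+1).1) mulrC.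
  exact: cauchy_schwarz_bdd (contr _ _ (PE k.+1)) (contr _ _ (PE k)).
- move=> k; have := Rintegral_bdd_by (probability_setT mu) (bdd_byM (PE k).1 (PE k).1).
  move/(le_trans (ler_norm _))/le_trans; apply.
  by rewrite le_eqVlt; apply/orP; left; apply/eqP; rewrite /ck -exprM mulnC exprM; ring.
Qed.

End bounded_gap.

(** * The real L^2 norm *)

Section square_integrable.
Context (R : realType) (d : measure_display) (S : measurableType d).
Implicit Types (m : {measure set S -> \bar R}) (f g : S -> R).

Definition sqnorm m f : \bar R := (\int[m]_x (f x ^+ 2)%:E)%E.

Definition norm2 m f : \bar R := ('N[m]_2%:E[EFin \o f])%E.

Definition sqint m f : Prop :=
  measurable_fun [set: S] f /\ (sqnorm m f < +oo)%E.

Lemma sqnorm_ge0 m f : (0 <= sqnorm m f)%E.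
Proof. by apply: integral_ge0 => x _; rewrite lee_fin sqr_ge0. Qed.

Lemma measurable_sqr f : measurable_fun [set: S] f ->
  measurable_fun [set: S] (fun x => (f x ^+ 2)%:E).
Proof. by move=> mf; apply/measurable_EFinP; exact: measurable_funX. Qed.

Lemma norm2E m f : norm2 m f = sqrte (sqnorm m f).
Proof.
rewrite /norm2 unlock -poweR12_sqrt ?sqnorm_ge0//; congr (_ `^ _)%E.
apply: eq_integral => x _.
rewrite -[(EFin \o f) x]/((f x)%:E) abse_EFin poweR_EFin powR_mulrn//.
by rewrite real_normK ?num_real.
Qed.

Lemma norm2_ge0 m f : (0 <= norm2 m f)%E.
Proof. exact: Lnorm_ge0. Qed.

Lemma norm2_le m f g (a : R) : 0 <= a ->
  (sqnorm m f <= (a ^+ 2)%:E * sqnorm m g)%E -> (norm2 m f <= a%:E * norm2 m g)%E.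
Proof.
move=> a0 h; have -> : a%:E = sqrte (a ^+ 2)%:E by rewrite /= sqrtr_sqr ger0_norm.
rewrite !norm2E -sqrteM ?lee_fin ?sqr_ge0// lee_sqrt// mule_ge0 ?sqnorm_ge0//.
by rewrite lee_fin sqr_ge0.
Qed.

Lemma norm2Z m (a : R) f : measurable_fun [set: S] f ->
  norm2 m (fun x => a * f x) = (`|a|%:E * norm2 m f)%E.
Proof.
move=> mf; have -> : `|a|%:E = sqrte (a ^+ 2)%:E by rewrite /= sqrtr_sqr.
rewrite !norm2E -sqrteM ?lee_fin ?sqr_ge0//; congr sqrte.
rewrite /sqnorm -ge0_integralZl//.
- by apply: eq_integral => x _; rewrite exprMn EFinM.
- exact: measurable_sqr.
- by move=> x _; rewrite lee_fin sqr_ge0.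
- by rewrite lee_fin sqr_ge0.
Qed.

Lemma norm2D m f g : measurable_fun [set: S] f -> measurable_fun [set: S] g ->
  (norm2 m (fun x => f x + g x)%R <= norm2 m f + norm2 m g)%E.
Proof.
by move=> mf mg; apply: (minkowski_EFin m mf mg); rewrite ler1n.
Qed.

Lemma norm2N m f : norm2 m (fun x => - f x) = norm2 m f.
Proof.
by rewrite !norm2E; congr sqrte; apply: eq_integral => x _; rewrite sqrrN.
Qed.

Lemma norm2B m f g : measurable_fun [set: S] f -> measurable_fun [set: S] g ->
  (norm2 m (fun x => f x - g x)%R <= norm2 m f + norm2 m g)%E.
Proof.
move=> mf mg; rewrite -(norm2N m g); apply: norm2D => //.
exact: measurableT_comp.
Qed.

Lemma ae_eq_norm2 m f g : measurable_fun [set: S] f -> measurable_fun [set: S] g ->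
  (\forall x \ae m, f x = g x) -> norm2 m f = norm2 m g.
Proof.
move=> mf mg fg; rewrite !norm2E; congr sqrte; apply: ge0_ae_eq_integral => //.
- exact: measurable_sqr.
- exact: measurable_sqr.
- by move=> x _; rewrite lee_fin sqr_ge0.
- by move=> x _; rewrite lee_fin sqr_ge0.
- by apply: filterS fg => x -> _.
Qed.

Lemma sqintP m f : sqint m f <-> measurable_fun [set: S] f /\ (norm2 m f < +oo)%E.
Proof.
rewrite /sqint norm2E; split=> -[mf h]; split => //.
  rewrite -ge0_fin_numE ?sqrte_ge0// sqrte_fin_num ?sqnorm_ge0//.
  by rewrite ge0_fin_numE ?sqnorm_ge0.
rewrite -ge0_fin_numE ?sqnorm_ge0// -sqrte_fin_num ?sqnorm_ge0//.
by rewrite ge0_fin_numE ?sqrte_ge0.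
Qed.

Lemma sqintB m f g : sqint m f -> sqint m g -> sqint m (fun x => f x - g x).
Proof.
move=> /sqintP[mf fy] /sqintP[mg gy]; apply/sqintP; split.
  exact: measurable_funB.
by rewrite (le_lt_trans (norm2B m mf mg))// lte_add_pinfty.
Qed.

Lemma sqint_integrable m f : (m [set: S] < +oo)%E -> sqint m f ->
  m.-integrable [set: S] (EFin \o f).
Proof.
move=> my [mf fy]; have i1 : m.-integrable [set: S] (EFin \o cst 1).
  exact: bdd_by_integrable my (bdd_by_cst 1).
have i2 : m.-integrable [set: S] (fun x => (f x ^+ 2)%:E).
  apply/integrableP; split; first exact: measurable_sqr.
  apply: le_lt_trans fy; rewrite le_eqVlt; apply/orP; left; apply/eqP.
  by apply: eq_integral => x _; rewrite gee0_abs// lee_fin sqr_ge0.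
apply: le_integrable (integrableD _ i1 i2) => //; first exact/measurable_EFinP.
move=> x _; rewrite /= lee_fin [leRHS]ger0_norm ?addr_ge0 ?sqr_ge0//.
rewrite -(real_normK (num_real (f x))).
have := sqr_ge0 (`|f x| - 1); have := normr_ge0 (f x); nra.
Qed.

Lemma bdd_by_sqint m c f : (m [set: S] < +oo)%E -> bdd_by c f -> sqint m f.
Proof.
move=> my fb; split; first exact: fb.1.
have := integrable_lty measurableT (bdd_by_integrable my (bdd_byM fb fb)).
by congr (_ < _)%E.
Qed.

(** Expand the nonnegative integral of [(f - a) ^+ 2], where [a] is the integral
    of [f]. *)
Lemma sqr_Rintegral_le m f : (m [set: S] <= 1)%E -> measurable_fun [set: S] f ->
  (((\int[m]_x f x) ^+ 2)%:E <= sqnorm m f)%E.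
Proof.
move=> m1 mf; have my : (m [set: S] < +oo)%E by rewrite (le_lt_trans m1) ?ltry.
have := sqnorm_ge0 m f; rewrite le_eqVlt.
have [->|fy] := eqVneq (sqnorm m f) +oo%E; first by rewrite leey.
move=> _; have sf : sqint m f by split => //; rewrite ltey.
have fi := sqint_integrable my sf.
have i2 : m.-integrable [set: S] (EFin \o (fun x => f x ^+ 2)).
  apply/integrableP; split; first exact: measurable_sqr.
  apply: le_lt_trans sf.2; rewrite le_eqVlt; apply/orP; left; apply/eqP.
  by apply: eq_integral => x _; rewrite gee0_abs// lee_fin sqr_ge0.
have -> : sqnorm m f = (\int[m]_x (f x ^+ 2))%:E.
  by rewrite fineK//; exact: integrable_fin_num i2.
rewrite lee_fin; set a := \int[m]_x f x.
have ai : m.-integrable [set: S] (EFin \o cst (a ^+ 2)).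
  exact: bdd_by_integrable my (bdd_by_cst _).
have fa : m.-integrable [set: S] (EFin \o (fun x => 2 * a * f x)).
  exact: (integrableZl measurableT (2 * a) fi).
have : 0 <= \int[m]_x (f x ^+ 2 - 2 * a * f x + cst (a ^+ 2) x).
  apply: Rintegral_ge0 => x _; have := sqr_ge0 (f x - a); rewrite /=; nra.
rewrite RintegralD//; last exact: (integrableB _ i2 fa).
rewrite RintegralB// RintegralZl// Rintegral_cst// -/a.
have : fine (m [set: S]) <= 1.
  by rewrite -lee_fin fineK// ge0_fin_numE.
have : 0 <= fine (m [set: S]) by apply: fine_ge0.
have := sqr_ge0 a; nra.
Qed.

End square_integrable.

(** * Markov operators on L^2 *)

Section kernel_integral.
Context (R : realType) (d d' : measure_display) (T : measurableType d')
  (S : measurableType d).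

(** The hypothesis is an equality of set functions, so that it applies to
    a law of the semigroup as well as to an invariant measure, which is the
    composition of the constant kernel [mu] with [K]. *)
Lemma integral_kernel_comp (l : R.-spker T ~> S) (K : R.-spker S ~> S) (x : T)
    (n : {measure set S -> \bar R}) (g : S -> \bar R) :
    (forall A, measurable A -> n A = kcomp_noparam l K x A) ->
    (forall y, (0 <= g y)%E) -> measurable_fun [set: S] g ->
  (\int[n]_y g y = \int[l x]_y \int[K y]_z g z)%E.
Proof.
move=> nE g0 mg.
rewrite -(integral_kcomp l (kernel.kernel_snd (T0 := T) K) x g0 mg).
apply: (eq_measure_integral (kcomp l (kernel.kernel_snd (T0 := T) K) x)).
by move=> A mA _; exact: nE.
Qed.

End kernel_integral.

Section markov_kernel_L2.
Context (R : realType) (d : measure_display) (S : measurableType d).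
Variables (mu : probability S R).
Implicit Types (K : R.-spker S ~> S) (f g : S -> R).

Let muy : (mu [set: S] < +oo)%E. Proof. by rewrite probability_setT ltry. Qed.

Lemma spker_lty K x : (K x [set: S] < +oo)%E.
Proof. by rewrite (le_lt_trans (sprob_kernel_le1 K x)) ?ltry. Qed.

Lemma integral_invariant K (g : S -> \bar R) : invariant_measure mu K ->
    (forall y, (0 <= g y)%E) -> measurable_fun [set: S] g ->
  (\int[mu]_x \int[K x]_y g y = \int[mu]_y g y)%E.
Proof.
move=> muK g0 mg; apply/esym.
pose l : R.-spker unit ~> S :=
  kprobability (@measurable_cst _ _ unit (pprobability S R) setT mu).
apply: (@integral_kernel_comp _ _ _ _ _ l K tt mu) => // A mA.
by apply/esym; exact: muK.
Qed.

Lemma measurable_sqnorm K f : measurable_fun [set: S] f ->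
  measurable_fun [set: S] (fun x => sqnorm (K x) f).
Proof.
move=> mf; apply: measurable_fun_integral_kernel => //.
- exact: measurable_kernel.
- by move=> y; rewrite lee_fin sqr_ge0.
- exact: measurable_sqr.
Qed.

(** The integral over [mu] of the second moments of [f] under [K x] is the
    second moment of [f] under [mu], which is finite. *)
Lemma ae_sqint K f : invariant_measure mu K -> sqint mu f ->
  \forall x \ae mu, sqint (K x) f.
Proof.
move=> muK [mf fy].
have i : mu.-integrable [set: S] (fun x => sqnorm (K x) f).
  apply/integrableP; split; first exact: measurable_sqnorm.
  apply: le_lt_trans fy; rewrite le_eqVlt; apply/orP; left; apply/eqP.
  rewrite -[RHS](integral_invariant muK).
  - by apply: eq_integral => x _; rewrite gee0_abs ?sqnorm_ge0.
  - by move=> y; rewrite lee_fin sqr_ge0.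
  - exact: measurable_sqr.
apply: filterS (integrable_ae measurableT i) => x /(_ Logic.I) h; split => //.
by rewrite -ge0_fin_numE ?sqnorm_ge0.
Qed.

(** Jensen's inequality for [K x], integrated against the invariant measure. *)
Lemma norm2_kop_le K f : invariant_measure mu K -> measurable_fun [set: S] f ->
  (norm2 mu (kop K f) <= norm2 mu f)%E.
Proof.
move=> muK mf; rewrite !norm2E lee_sqrt ?sqnorm_ge0//.
rewrite [leRHS]/sqnorm -(integral_invariant muK); last exact: measurable_sqr.
  apply: ge0_le_integral => //.
  - by move=> x _; rewrite lee_fin sqr_ge0.
  - by apply: measurable_sqr; exact: measurable_kop.
  - exact: measurable_sqnorm.
  - by move=> x _; apply: sqr_Rintegral_le => //; exact: sprob_kernel_le1.
by move=> y; rewrite lee_fin sqr_ge0.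
Qed.

Lemma sqint_kop K f : invariant_measure mu K -> sqint mu f -> sqint mu (kop K f).
Proof.
move=> muK /sqintP[mf fy]; apply/sqintP; split; first exact: measurable_kop.
exact: le_lt_trans (norm2_kop_le muK mf) fy.
Qed.

Lemma ae_kopD K f g : invariant_measure mu K -> sqint mu f -> sqint mu g ->
  \forall x \ae mu, kop K (fun y => f y + g y) x = kop K f x + kop K g x.
Proof.
move=> muK /(ae_sqint muK) fi /(ae_sqint muK) gi.
apply: filterS2 fi gi => x fi gi; rewrite /kop RintegralD//.
  exact: sqint_integrable (spker_lty K x) fi.
exact: sqint_integrable (spker_lty K x) gi.
Qed.

(** Composition of kernels is known for nonnegative functions; the positive
    and negative parts of [f] can be recombined at almost every [x] because both
    have finite integrals under [Q x]. *)
Lemma ae_kop_comp (Q K1 K2 : R.-spker S ~> S) f : invariant_measure mu Q ->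
    (forall x A, measurable A -> Q x A = kcomp_noparam K1 K2 x A) ->
    sqint mu f ->
  \forall x \ae mu, kop Q f x = kop K1 (kop K2 f) x.
Proof.
move=> muQ QE sf; apply: filterS (ae_sqint muQ sf) => x sfx.
have fi := sqint_integrable (spker_lty Q x) sfx.
have mf : measurable_fun [set: S] (EFin \o f) by apply/measurable_EFinP; exact: sf.1.
pose h := EFin \o f.
(* [a] and [b] are integrable, so that their difference is finite almost
   everywhere and agrees there with [kop K2 f]. *)
pose a y := (\int[K2 y]_z h^\+ z)%E; pose b y := (\int[K2 y]_z h^\- z)%E.
have a0 y : (0 <= a y)%E by apply: integral_ge0.
have b0 y : (0 <= b y)%E by apply: integral_ge0.
have ma : measurable_fun [set: S] a.
  apply: measurable_fun_integral_kernel => //; first exact: measurable_kernel.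
  exact: measurable_funepos.
have mb : measurable_fun [set: S] b.
  apply: measurable_fun_integral_kernel => //; first exact: measurable_kernel.
  exact: measurable_funeneg.
have aE : (\int[Q x]_y h^\+ y = \int[K1 x]_y a y)%E.
  by apply: integral_kernel_comp => //; [exact: QE|exact: measurable_funepos].
have bE : (\int[Q x]_y h^\- y = \int[K1 x]_y b y)%E.
  by apply: integral_kernel_comp => //; [exact: QE|exact: measurable_funeneg].
have ai : (K1 x).-integrable [set: S] a.
  apply/integrableP; split => //.
  under eq_integral => y _ do rewrite gee0_abs//.
  rewrite -aE -ge0_fin_numE ?integral_ge0//; exact: integrable_pos_fin_num.
have bi : (K1 x).-integrable [set: S] b.
  apply/integrableP; split => //.
  under eq_integral => y _ do rewrite gee0_abs//.
  rewrite -bE -ge0_fin_numE ?integral_ge0//; exact: integrable_neg_fin_num.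
rewrite /kop /Rintegral; congr fine.
rewrite [LHS]integralE -/h aE bE -integralB//.
apply: ae_eq_integral => //.
- exact: emeasurable_funB.
- by apply/measurable_EFinP; exact: measurable_kop sf.1.
- apply: filterS2 (integrable_ae measurableT ai) (integrable_ae measurableT bi).
  move=> y /(_ Logic.I) ay /(_ Logic.I) bY _.
  by rewrite -/(kop K2 f) /kop /Rintegral integralE -/h fineK// fin_numB ay bY.
Qed.

End markov_kernel_L2.

(** * From bounded to square-integrable functions *)

Section truncation.
Context (R : realType) (d : measure_display) (S : measurableType d).
Variables (mu : probability S R).
Implicit Types (f g u : S -> R).

Let muy : (mu [set: S] < +oo)%E. Proof. by rewrite probability_setT ltry. Qed.

Lemma norm2_cst (a : R) : norm2 mu (cst a) = `|a|%:E.
Proof.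
rewrite norm2E /sqnorm -[X in sqrte X]/(\int[mu]_x (cst (a ^+ 2)%:E x))%E.
rewrite integral_cst// -[X in (_ * X)%E]/(mu [set: S]) probability_setT.
by rewrite mule1 /= sqrtr_sqr.
Qed.

Lemma abs_Rintegral_le f : measurable_fun [set: S] f ->
  (`|\int[mu]_x f x|%:E <= norm2 mu f)%E.
Proof.
move=> mf; rewrite -sqrtr_sqr norm2E -[X in (X <= _)%E]/(sqrte (_ ^+ 2)%:E).
rewrite lee_sqrt ?sqnorm_ge0//; apply: sqr_Rintegral_le => //.
exact: probability_le1.
Qed.

(** Truncation, with dominated convergence. *)
Lemma bounded_dense g (del : R) : 0 < del -> sqint mu g ->
  exists c u, [/\ 0 <= c, bdd_by c u & (norm2 mu (fun x => g x - u x)%R <= del%:E)%E].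
Proof.
move=> del0 [mg gy].
(* Values outside the window are set to 0, so that [(g - u n) ^+ 2] is
   dominated by [g ^+ 2]. *)
pose u n x := if `|g x| <= n%:R then g x else 0.
have mu_ n : measurable_fun [set: S] (u n).
  pose A := [set x | `|g x| <= n%:R].
  have mA : measurable A.
    have -> : A = [set: S] `&` (Num.Def.normr \o g) @^-1` `]-oo, n%:R].
      by apply/seteqP; split => x; rewrite setTI /A /= in_itv.
    by apply: (measurableT_comp (@normr_measurable R setT) mg).
  have -> : u n = (fun x => g x * \1_A x).
    apply/funext => x; rewrite /u indicE.
    have -> : (x \in A) = (`|g x| <= n%:R) by apply/idP/idP; rewrite inE.
    by case: ifP; rewrite ?mulr1 ?mulr0.
  by apply: measurable_funM => //; exact: measurable_indic.
have ub n : bdd_by n%:R (u n).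
  by split => // x; rewrite /u; case: ifPn => // _; rewrite normr0.
have : (\int[mu]_x ((g x - u n x) ^+ 2)%:E)%E @[n --> \oo] --> (\int[mu]_x (cst 0 x))%E.
  apply: (@dominated_cvg _ _ _ mu setT measurableT _ _ (fun x => (g x ^+ 2)%:E)) => //.
  - by move=> n; apply: measurable_sqr; exact: measurable_funB.
  - move=> x _; apply: cvg_near_cst.
    exists (Num.bound `|g x|) => // n /= bn; rewrite /u ifT ?subrr ?expr0n//.
    by rewrite (le_trans (ltW (archi_boundP (normr_ge0 _))))// ler_nat.
  - apply/integrableP; split; first exact: measurable_sqr.
    apply: le_lt_trans gy; rewrite le_eqVlt; apply/orP; left; apply/eqP.
    by apply: eq_integral => x _; rewrite gee0_abs// lee_fin sqr_ge0.
  - move=> n x _; rewrite gee0_abs ?lee_fin ?sqr_ge0// /u.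
    by case: ifP => _; rewrite ?subr0// subrr expr0n sqr_ge0.
rewrite integral0 => /(_ _ (open_ereal_lt' _)) H.
have /H[n _ /(_ n (leqnn n))/= un] : (0 < (del ^+ 2)%:E)%E by rewrite lte_fin exprn_gt0.
exists n%:R, (u n); split => //.
rewrite -[del]gtr0_norm// -sqrtr_sqr norm2E -[X in (_ <= X)%E]/(sqrte (_ ^+ 2)%:E).
by rewrite lee_sqrt ?lee_fin ?sqr_ge0// ltW.
Qed.

(** Subtracting its mean from the truncation costs at most as much again,
    because the mean of [u] is that of [u - g]. *)
Lemma bounded_dense_mean0 g (del : R) : 0 < del -> sqint mu g ->
    \int[mu]_x g x = 0 ->
  exists c u, [/\ 0 <= c, bdd_by c u, \int[mu]_x u x = 0 &
    (norm2 mu (fun x => g x - u x)%R <= del%:E)%E].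
Proof.
move=> del0 sg g0; have del2 : 0 < del / 2 by rewrite divr_gt0.
have [c [u [c0 uc gu]]] := bounded_dense del2 sg.
pose a := \int[mu]_x u x.
have mgu : measurable_fun [set: S] (fun x => g x - u x).
  by apply: measurable_funB; [exact: sg.1|exact: uc.1].
have ca : bdd_by `|a| (cst a : S -> R) := bdd_by_cst a.
have iu := bdd_by_integrable muy uc.
have aE : (`|a|%:E <= norm2 mu (fun x => g x - u x)%R)%E.
  have -> : a = - \int[mu]_x (g x - u x).
    by rewrite RintegralB// ?g0 ?sub0r ?opprK//; exact: sqint_integrable.
  by rewrite normrN; exact: abs_Rintegral_le.
exists (c + `|a|), (fun x => u x - cst a x); split.
- by rewrite addr_ge0.
- exact: bdd_byB.
- rewrite RintegralB//; last exact: bdd_by_integrable ca.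
  by rewrite Rintegral_cst// -[X in fine X]/(mu [set: S]) probability_setT mulr1 subrr.
- rewrite (_ : (fun x => _) = (fun x => (g x - u x) + cst a x)); last first.
    by apply/funext => x; rewrite opprB addrA addrAC.
  apply: le_trans (norm2D _ _ _) _ => //.
  by rewrite norm2_cst (splitr del) EFinD leeD// (le_trans aE).
Qed.

End truncation.

Section contraction.
Context (R : realType) (d : measure_display) (S : measurableType d).
Variables (mu : probability S R) (K : R.-spker S ~> S).
Hypothesis K1 : forall x, K x [set: S] = 1%E.
Hypothesis muK : invariant_measure mu K.

Let muy : (mu [set: S] < +oo)%E. Proof. by rewrite probability_setT ltry. Qed.

Lemma sqnorm_bdd c (f : S -> R) : bdd_by c f ->
  sqnorm mu f = (\int[mu]_x (f x * f x))%:E.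
Proof.
move=> fb; rewrite fineK//.
exact: (integrable_fin_num measurableT (bdd_by_integrable muy (bdd_byM fb fb))).
Qed.

(** Density of the bounded centred functions, together with the contraction of
    [K] on the remainder. *)
Lemma norm2_kop_mean0 eps g : 0 < eps -> (mix_dist mu K <= eps%:E)%E ->
    sqint mu g -> \int[mu]_x g x = 0 ->
  (norm2 mu (kop K g) <= (Num.sqrt (2 * eps))%:E * norm2 mu g)%E.
Proof.
move=> eps0 mix sg g0; pose s := Num.sqrt (2 * eps).
have s0 : 0 <= s by exact: sqrtr_ge0.
apply/lee_addgt0Pr => e e0; pose del := e / (1 + s).
have del0 : 0 < del by rewrite divr_gt0// ltr_pwDl.
have [c [u [c0 uc u0 gu]]] := bounded_dense_mean0 del0 sg g0.
have su := bdd_by_sqint muy uc; have sgu := sqintB sg su.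
have mu' := su.1; have mg := sg.1; have mgu := sgu.1.
have mKu := measurable_kop K mu'; have mKgu := measurable_kop K mgu.
have Ku : (norm2 mu (kop K u) <= s%:E * norm2 mu u)%E.
  apply: norm2_le => //; rewrite /s sqr_sqrtr; last by rewrite mulr_ge0// ltW.
  rewrite (sqnorm_bdd (bdd_by_kop K1 uc)) (sqnorm_bdd uc) lee_fin.
  exact: (kop_sqr_le_bdd K1 muK eps0 mix c0 uc u0).
have uE : (norm2 mu u <= norm2 mu g + del%:E)%E.
  rewrite (_ : u = (fun x => g x - (g x - u x))); last first.
    by apply/funext => x; rewrite subKr.
  by apply: le_trans (norm2B _ _ _) _ => //; rewrite leeD2l.
have -> : norm2 mu (kop K g) =
    norm2 mu (fun x => kop K u x + kop K (fun y => g y - u y) x).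
  apply: ae_eq_norm2; [exact: measurable_kop|exact: measurable_funD|].
  apply: filterS (ae_kopD muK su sgu) => x <-.
  by congr (kop K _ x); apply/funext => y; rewrite subrKC.
apply: le_trans (norm2D _ _ _) _ => //.
apply: (@le_trans _ _ (s%:E * (norm2 mu g + del%:E) + del%:E)%E).
  apply: leeD; first by rewrite (le_trans Ku)// lee_wpmul2l.
  by rewrite (le_trans (norm2_kop_le _ _)).
rewrite muleDr ?fin_num_adde_defl// -addeA leeD2l// -EFinM -EFinD lee_fin.
rewrite -[X in _ + X]mul1r -mulrDl [s + 1]addrC /del mulrC divfK//.
by rewrite gt_eqF// ltr_pwDl.
Qed.

End contraction.

Section iterates.
Context (R : realType) (d : measure_display) (S : measurableType d).
Variables (mu : probability S R).
Implicit Types (K Q : R.-spker S ~> S) (f : S -> R).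

Lemma invariant_comp (K1 K2 Q : R.-spker S ~> S) :
    (forall x A, measurable A -> Q x A = kcomp_noparam K1 K2 x A) ->
    invariant_measure mu K1 -> invariant_measure mu K2 ->
  invariant_measure mu Q.
Proof.
move=> QE muK1 muK2 A mA; rewrite /kernel_push.
under eq_integral => x _ do rewrite QE// /kcomp_noparam.
rewrite (integral_invariant muK1)//; last exact: measurable_kernel.
exact: muK2.
Qed.

Lemma kop_dirac Q f : (forall x A, measurable A -> Q x A = \d_x A) ->
  measurable_fun [set: S] f -> kop Q f = f.
Proof.
move=> Q0 mf; apply/funext => x; rewrite /kop /Rintegral.
rewrite (eq_measure_integral \d_x); last by move=> A mA _; exact: Q0.
by rewrite integral_dirac ?diracT ?mul1e//; exact/measurable_EFinP.
Qed.

(** Telescoping: [Q (k + 1) f - f = K (Q k f - f) + (K f - f)], and [K] is a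
    contraction. *)
Lemma norm2_iterate_le K (Q : nat -> R.-spker S ~> S) f n :
    (forall x A, measurable A -> Q 0%N x A = \d_x A) ->
    (forall k x A, measurable A -> Q k.+1 x A = kcomp_noparam K (Q k) x A) ->
    invariant_measure mu K -> (forall k, invariant_measure mu (Q k)) ->
    sqint mu f ->
  (norm2 mu (fun x => kop (Q n) f x - f x)%R <=
    n%:R%:E * norm2 mu (fun x => kop K f x - f x)%R)%E.
Proof.
move=> Q0 QS muK muQ sf; have mf := sf.1; elim: n => [|n IH].
  rewrite mul0e (kop_dirac Q0)//.
  rewrite (_ : (fun x => _) = cst 0) ?norm2_cst ?normr0//.
  by apply/funext => x; rewrite subrr.
have sQ := sqint_kop (muQ n) sf; have sQf := sqintB sQ sf.
have mKf := measurable_kop K mf; have mKQf := measurable_kop K sQf.1.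
have mQf := measurable_kop (Q n.+1) mf.
have -> : norm2 mu (fun x => kop (Q n.+1) f x - f x) =
  norm2 mu (fun x => kop K (fun y => kop (Q n) f y - f y) x + (kop K f x - f x)).
  apply: ae_eq_norm2; [exact: measurable_funB| |].
    by apply: measurable_funD => //; exact: measurable_funB.
  apply: filterS2 (ae_kop_comp (muQ n.+1) (QS n) sf) (ae_kopD muK sQf sf).
  move=> x -> h; rewrite addrA -h; congr (kop K _ x - _).
  by apply/funext => y; rewrite subrK.
apply: le_trans (norm2D _ _ _) _ => //; first exact: measurable_funB.
rewrite -natr1 EFinD ge0_muleDl// mul1e leeD2r//.
by apply: le_trans IH; apply: norm2_kop_le => //; exact: sQf.1.
Qed.

(** The triangle inequality [norm f <= norm (Q f) + norm (Q f - f)], where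
    mixing makes the first term at most [sqrt (2 * eps) * norm f]. *)
Lemma norm2_le_of_mixing Q eps f (D : \bar R) :
    (forall x, Q x [set: S] = 1%E) -> invariant_measure mu Q -> 0 < eps ->
    (mix_dist mu Q <= eps%:E)%E -> sqint mu f -> \int[mu]_x f x = 0 ->
    (norm2 mu (fun x => kop Q f x - f x)%R <= D)%E ->
  ((1 - Num.sqrt (2 * eps))%:E * norm2 mu f <= D)%E.
Proof.
move=> Q1 muQ eps0 mix sf f0 hD; have mf := sf.1.
have fN : norm2 mu f \is a fin_num.
  by have /sqintP[_ h] := sf; rewrite ge0_fin_numE// norm2_ge0.
have mQ := measurable_kop Q mf.
rewrite EFinB muleBl// mul1e leeBlDr ?fin_numM//.
apply: (@le_trans _ _ (norm2 mu (kop Q f) + norm2 mu (fun x => kop Q f x - f x)%R)%E).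
  rewrite [X in (norm2 _ X <= _)%E](_ : f = (fun x => kop Q f x - (kop Q f x - f x))).
    by apply: norm2B => //; exact: measurable_funB.
  by apply/funext => x; rewrite subKr.
by rewrite addeC leeD//; exact: norm2_kop_mean0.
Qed.

End iterates.

(** * Semigroups and powers of a kernel *)

Section semigroup.
Context (R : realType) (d : measure_display) (S : measurableType d).
Variables (mu : probability S R) (P : R -> R.-pker S ~> S).
Hypothesis PP : markov_transition P.
Hypothesis muP : forall t, 0 <= t -> invariant_measure mu (P t).
Implicit Types (f g : S -> R).

Lemma norm2_semigroup_le f n h : 0 <= h -> sqint mu f ->
  (norm2 mu (fun x => kop (P (n%:R * h)) f x - f x)%R <=
    n%:R%:E * norm2 mu (fun x => kop (P h) f x - f x)%R)%E.
Proof.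
move=> h0 sf; apply: (norm2_iterate_le (K := P h) (Q := fun k => P (k%:R * h))) => //.
- by move=> x A mA; rewrite mul0r; exact: PP.1.
- move=> k x A mA; rewrite -natr1 mulrDl mul1r addrC.
  by apply: PP.2 => //; rewrite mulr_ge0.
- exact: muP.
- by move=> k; apply: muP; rewrite mulr_ge0.
Qed.

(** Telescoping over [n] steps of length [h = t / n] bounds the left-hand side
    by [t] times the norm of the difference quotient at [h], which tends to [g]. *)
Lemma norm2_generator_le f g t : 0 <= t -> sqint mu f -> sqint mu g ->
    norm2 mu (fun x => h^-1 * (kop (P h) f x - f x) - g x) @[h --> 0^'+] --> 0%E ->
  (norm2 mu (fun x => kop (P t) f x - f x)%R <= t%:E * norm2 mu g)%E.
Proof.
rewrite le_eqVlt => /predU1P[<- sf _ _|t0 sf sg lim].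
  rewrite mul0e (kop_dirac PP.1 sf.1) (_ : (fun x => _) = cst 0).
    by rewrite norm2_cst normr0.
  by apply/funext => x; rewrite subrr.
apply/lee_addgt0Pr => e e0.
have : (0 < (e / t)%:E)%E by rewrite lte_fin divr_gt0.
move=> /open_ereal_lt'/lim [r /= r0 hr].
(* A step [h] that divides [t] and lies within the range [r] in which the
   difference quotient is close to [g]. *)
pose n := Num.bound (t / r); pose h := t / n.+1%:R.
have h0 : 0 < h by rewrite divr_gt0.
have hlt : h < r.
  rewrite /h ltr_pdivrMr// mulrC -ltr_pdivrMr//.
  rewrite (@lt_trans _ _ n%:R) ?ltr_nat//.
  by apply: archi_boundP; rewrite divr_ge0 ?ltW.
have {}hr := hr h _ h0.
have [mf mg mPh] := And3 sf.1 sg.1 (measurable_kop (P h) sf.1).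
set F := fun x => h^-1 * (kop (P h) f x - f x) - g x in hr.
have mF : measurable_fun [set: S] F.
  by apply: measurable_funB => //; apply: measurable_funM => //; exact: measurable_funB.
have {}hr : (norm2 mu F <= (e / t)%:E)%E.
  by apply/ltW/hr; rewrite /= sub0r normrN gtr0_norm.
have tE : t = n.+1%:R * h by rewrite /h mulrC divfK.
have nle := norm2_semigroup_le n.+1 (ltW h0) sf; rewrite -tE in nle.
apply: le_trans nle _.
have -> : (fun x => kop (P h) f x - f x) = (fun x => h * (F x + g x)).
  by apply/funext => x; rewrite /F subrK mulrA divff ?mul1r// gt_eqF.
rewrite norm2Z; last exact: measurable_funD.
rewrite gtr0_norm// muleA -EFinM -tE.
apply: (@le_trans _ _ (t%:E * ((e / t)%:E + norm2 mu g))%E).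
  apply: lee_wpmul2l; first by rewrite lee_fin ltW.
  by apply: le_trans (norm2D _ _ _) _ => //; rewrite leeD2r.
rewrite muleDr ?fin_num_adde_defr// -EFinM addeC leeD2l// lee_fin.
by rewrite mulrC divfK// gt_eqF.
Qed.

End semigroup.

Section kernel_powers.
Context (R : realType) (d : measure_display) (S : measurableType d).
Variables (mu : probability S R) (P : R.-pker S ~> S).

Lemma kernel_pow_setT n x : kernel_pow P n x [set: S] = 1%E.
Proof.
elim: n x => [|n IH] x; first exact: diracT.
transitivity (\int[P x]_y kernel_pow P n y [set: S])%E; first by [].
under eq_integral => y _ do rewrite IH.
by rewrite integral_cst// mul1e prob_kernel.
Qed.

Lemma invariant_kernel_pow n : invariant_measure mu P ->
  invariant_measure mu (kernel_pow P n).
Proof.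
move=> muP; elim: n => [|n IH]; last exact: (invariant_comp _ muP IH).
move=> A mA; rewrite /kernel_push.
transitivity (\int[mu]_x (\1_A x)%:E)%E; first by [].
by rewrite integral_indic// setIT.
Qed.

Lemma norm2_kernel_pow_le f n : invariant_measure mu P -> sqint mu f ->
  (norm2 mu (fun x => kop (kernel_pow P n) f x - f x)%R <=
    n%:R%:E * norm2 mu (fun x => kop P f x - f x)%R)%E.
Proof.
move=> muP sf; apply: norm2_iterate_le => // k.
exact: invariant_kernel_pow.
Qed.

End kernel_powers.

(** * Complex functions and the gap *)

Section complex_functions.
Context (R : realType) (d : measure_display) (S : measurableType d).
Variable (mu : probability S R).
Implicit Types (f g : S -> R[i]).

Lemma L2normE f :
    measurable_fun [set: S] (fun x => complex.Re (f x)) ->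
    measurable_fun [set: S] (fun x => complex.Im (f x)) ->
  L2norm mu f = sqrte (sqnorm mu (fun x => complex.Re (f x)) +
                       sqnorm mu (fun x => complex.Im (f x)))%E.
Proof.
move=> mre mim; transitivity (norm2 mu (fun x => Normc.normc (f x))); first by [].
rewrite norm2E; congr sqrte; rewrite /sqnorm -ge0_integralD//.
- apply: eq_integral => x _; case: (f x) => a b /=.
  by rewrite sqr_sqrtr ?addr_ge0 ?sqr_ge0// EFinD.
- by move=> x _; rewrite lee_fin sqr_ge0.
- exact: measurable_sqr.
- by move=> x _; rewrite lee_fin sqr_ge0.
- exact: measurable_sqr.
Qed.

Lemma norm2_Re_le f :
    measurable_fun [set: S] (fun x => complex.Re (f x)) ->
    measurable_fun [set: S] (fun x => complex.Im (f x)) ->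
  (norm2 mu (fun x => complex.Re (f x)) <= L2norm mu f)%E.
Proof.
move=> mre mim; rewrite L2normE// norm2E lee_sqrt; last first.
  exact: adde_ge0 (sqnorm_ge0 _ _) (sqnorm_ge0 _ _).
by rewrite leeDl ?sqnorm_ge0.
Qed.

Lemma norm2_Im_le f :
    measurable_fun [set: S] (fun x => complex.Re (f x)) ->
    measurable_fun [set: S] (fun x => complex.Im (f x)) ->
  (norm2 mu (fun x => complex.Im (f x)) <= L2norm mu f)%E.
Proof.
move=> mre mim; rewrite L2normE// norm2E lee_sqrt; last first.
  exact: adde_ge0 (sqnorm_ge0 _ _) (sqnorm_ge0 _ _).
by rewrite leeDr ?sqnorm_ge0.
Qed.

Lemma L2_sqint f : L2 mu f ->
  sqint mu (fun x => complex.Re (f x)) /\ sqint mu (fun x => complex.Im (f x)).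
Proof.
move=> [mre mim fy]; split; apply/sqintP; split => //.
  exact: le_lt_trans (norm2_Re_le mre mim) fy.
exact: le_lt_trans (norm2_Im_le mre mim) fy.
Qed.

Lemma L2norm_eq0 f : L2 mu f -> L2norm mu f = 0%E -> f = (fun=> 0) %[ae mu].
Proof.
move=> [mre mim _] f0.
have re0 : norm2 mu (fun x => complex.Re (f x)) = 0%E.
  by apply/eqP; rewrite eq_le norm2_ge0 andbT -f0 norm2_Re_le.
have im0 : norm2 mu (fun x => complex.Im (f x)) = 0%E.
  by apply/eqP; rewrite eq_le norm2_ge0 andbT -f0 norm2_Im_le.
have two : (0 < 2%:E :> \bar R)%E by rewrite lte_fin.
have := Lnorm_eq0_eq0 (iffRL (measurable_EFinP _ _) mre) two re0.
have := Lnorm_eq0_eq0 (iffRL (measurable_EFinP _ _) mim) two im0.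
apply: filterS2 => x /(_ Logic.I)/= + /(_ Logic.I)/= + _.
by case: (f x) => a b /= [->] [->].
Qed.

Lemma L2norm_le_of_Re_Im f g (c t : R) : 0 <= c -> 0 <= t -> L2 mu f -> L2 mu g ->
    (c%:E * norm2 mu (fun x => complex.Re (f x)) <=
      t%:E * norm2 mu (fun x => complex.Re (g x)))%E ->
    (c%:E * norm2 mu (fun x => complex.Im (f x)) <=
      t%:E * norm2 mu (fun x => complex.Im (g x)))%E ->
  (c%:E * L2norm mu f <= t%:E * L2norm mu g)%E.
Proof.
move=> c0 t0 [mfr mfi _] [mgr mgi _].
have sq (a : R) (X : \bar R) : 0 <= a -> (0 <= X)%E ->
    (a%:E * sqrte X)%E = sqrte ((a ^+ 2)%:E * X)%E.
  by move=> a0 X0; rewrite sqrteM ?lee_fin ?sqr_ge0//= sqrtr_sqr ger0_norm.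
have nn (u v : S -> R) : (0 <= sqnorm mu u + sqnorm mu v)%E.
  exact: adde_ge0 (sqnorm_ge0 _ _) (sqnorm_ge0 _ _).
have sqr0 (a : R) : (0 <= (a ^+ 2)%:E)%E by rewrite lee_fin sqr_ge0.
rewrite !L2normE// !norm2E !sq ?nn ?sqnorm_ge0//.
rewrite !lee_sqrt; try by apply: mule_ge0; rewrite ?sqr0 ?nn ?sqnorm_ge0.
move=> hr hi; rewrite !(ge0_muleDr _ (sqnorm_ge0 _ _) (sqnorm_ge0 _ _)).
exact: leeD.
Qed.

(** The hypothesis at [t = 0] forces every [f] in [L2_0] to vanish almost
    everywhere; the infimum is then taken over the empty set and is infinite. *)
Lemma gap_ge (L : (S -> R[i]) -> (S -> R[i]) -> Prop) (c t : R) :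
    0 < c -> 0 <= t ->
    (forall f g, L f g -> L2_0 mu f -> (c%:E * L2norm mu f <= t%:E * L2norm mu g)%E) ->
  (0 < t -> ((c / t)%:E <= singular_value_gap mu L)%E) /\
  (c%:E / singular_value_gap mu L <= t%:E)%E.
Proof.
move=> c0 t0 Lfg; set gamma := singular_value_gap mu L.
have normP f : L2_0 mu f -> ~ f = (fun=> 0) %[ae mu] ->
    exists2 F, 0 < F & L2norm mu f = F%:E.
  move=> [sf _] fN0; exists (fine (L2norm mu f)).
    rewrite fine_gt0//; have [_ _ ->] := sf; rewrite andbT lt_neqAle Lnorm_ge0 andbT.
    by apply/eqP => f0; apply: fN0; exact: L2norm_eq0.
  by rewrite fineK// ge0_fin_numE ?Lnorm_ge0//; case: sf.
have gamma_ge : 0 < t -> ((c / t)%:E <= gamma)%E.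
  move=> tp; apply: le_ereal_inf_tmp => _ [f [g [fg f0 fN0 ->]]].
  have [F F0 fF] := normP f f0 fN0; have := Lfg f g fg f0.
  rewrite fF => h; rewrite inver gt_eqF// lee_pdivlMr//.
  rewrite -(@lee_pmul2l _ t%:E)// muleA -EFinM (_ : t * (c / t) = c)//.
  by rewrite mulrC divfK// gt_eqF.
split => //; move: (t0); rewrite le_eqVlt => /predU1P[t00|tp].
  rewrite (_ : gamma = +oo%E) ?invey ?mule0//.
  rewrite /gamma /singular_value_gap (_ : [set r | _] = set0) ?ereal_inf0//.
  apply/seteqP; split => // r [f [g [fg f0 fN0 _]]].
  have [F F0 fF] := normP f f0 fN0; have := Lfg f g fg f0.
  by rewrite fF -t00 mul0e lee_fin leNgt mulr_gt0.
move: (gamma_ge tp) => {gamma_ge}; case: gamma => [r| |//].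
  rewrite lee_fin => cr; have r0 : 0 < r by rewrite (lt_le_trans _ cr)// divr_gt0.
  by rewrite inver gt_eqF// lee_fin ler_pdivrMr// mulrC -ler_pdivrMr.
by rewrite invey mule0 lee_fin.
Qed.

End complex_functions.

Section generator_bounds.
Context (R : realType) (d : measure_display) (S : measurableType d).
Variables (mu : probability S R) (eps : R).
Hypothesis eps_gt0 : 0 < eps.

Lemma generator_bound (P : R -> R.-pker S ~> S) t f g :
    markov_transition P -> (forall s, 0 <= s -> invariant_measure mu (P s)) ->
    0 <= t -> (mix_dist mu (P t) <= eps%:E)%E ->
    generator mu P f g -> L2_0 mu f -> 0 <= 1 - Num.sqrt (2 * eps) ->
  ((1 - Num.sqrt (2 * eps))%:E * L2norm mu f <= t%:E * L2norm mu g)%E.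
Proof.
move=> PP muP t0 mix [Lf Lg lim] [_ f0] s0.
have [sfr sfi] := L2_sqint Lf; have [sgr sgi] := L2_sqint Lg.
have [fr0 fi0] : \int[mu]_x complex.Re (f x) = 0 /\ \int[mu]_x complex.Im (f x) = 0.
  by move: f0 => [].
pose D h x := real_complex R h^-1 * (kernel_op (P h) f x - f x) - g x.
have ReD h : (fun x => complex.Re (D h x)) = (fun x =>
    h^-1 * (kop (P h) (fun y => complex.Re (f y)) x - complex.Re (f x)) - complex.Re (g x)).
  apply/funext => x; rewrite /D /kernel_op /Cintegral.
  by case: (f x) => a b; case: (g x) => a' b' /=; rewrite mul0r subr0.
have ImD h : (fun x => complex.Im (D h x)) = (fun x =>
    h^-1 * (kop (P h) (fun y => complex.Im (f y)) x - complex.Im (f x)) - complex.Im (g x)).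
  apply/funext => x; rewrite /D /kernel_op /Cintegral.
  by case: (f x) => a b; case: (g x) => a' b' /=; rewrite mul0r addr0.
have mdq h (u v : S -> R) : measurable_fun [set: S] u -> measurable_fun [set: S] v ->
    measurable_fun [set: S] (fun x => h^-1 * (kop (P h) u x - u x) - v x).
  move=> mu' mv; apply: measurable_funB => //; apply: measurable_funM => //.
  by apply: measurable_funB => //; exact: measurable_kop.
have mRe h : measurable_fun [set: S] (fun x => complex.Re (D h x)).
  by rewrite ReD; apply: mdq; [exact: sfr.1|exact: sgr.1].
have mIm h : measurable_fun [set: S] (fun x => complex.Im (D h x)).
  by rewrite ImD; apply: mdq; [exact: sfi.1|exact: sgi.1].
have P1 x : P t x [set: S] = 1%E by exact: prob_kernel.
have squeeze (G : R -> \bar R) : (forall h, (0 <= G h <= L2norm mu (D h))%E) ->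
    G h @[h --> 0^'+] --> 0%E.
  move=> G_le.
  have G_near : \forall h \near 0^'+, (cst 0 h <= G h <= L2norm mu (D h))%E.
    by apply: nearW => h; exact: G_le.
  by apply: (squeeze_cvge G_near _ lim); exact: cvg_cst.
apply: L2norm_le_of_Re_Im => //.
- apply: (norm2_le_of_mixing _ _ _ mix sfr fr0) => //; first exact: muP.
  apply: (norm2_generator_le PP muP t0 sfr sgr).
  apply: squeeze => h.
  by rewrite norm2_ge0 -ReD norm2_Re_le.
- apply: (norm2_le_of_mixing _ _ _ mix sfi fi0) => //; first exact: muP.
  apply: (norm2_generator_le PP muP t0 sfi sgi).
  apply: squeeze => h.
  by rewrite norm2_ge0 -ImD norm2_Im_le.
Qed.

Lemma discrete_generator_bound (P : R.-pker S ~> S) n f g :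
    invariant_measure mu P -> (mix_dist mu (kernel_pow P n) <= eps%:E)%E ->
    discrete_generator mu P f g -> L2_0 mu f -> 0 <= 1 - Num.sqrt (2 * eps) ->
  ((1 - Num.sqrt (2 * eps))%:E * L2norm mu f <= n%:R%:E * L2norm mu g)%E.
Proof.
move=> muP mix [Lf Lg gE] [_ f0] s0.
have [sfr sfi] := L2_sqint Lf; have [sgr sgi] := L2_sqint Lg.
have [fr0 fi0] : \int[mu]_x complex.Re (f x) = 0 /\ \int[mu]_x complex.Im (f x) = 0.
  by move: f0 => [].
have mq (u : S -> R) : measurable_fun [set: S] u ->
    measurable_fun [set: S] (fun x => kop P u x - u x).
  by move=> mu'; apply: measurable_funB => //; exact: measurable_kop.
have Pn1 x := kernel_pow_setT P n x.
have muPn := invariant_kernel_pow n muP.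
apply: L2norm_le_of_Re_Im => //.
- apply: (norm2_le_of_mixing _ _ _ mix sfr fr0) => //.
  apply: le_trans (norm2_kernel_pow_le n muP sfr) _.
  rewrite (ae_eq_norm2 sgr.1 (mq _ sfr.1))//.
  apply: filterS gE => x /(_ Logic.I) ->; rewrite /kernel_op /Cintegral.
  by case: (f x).
- apply: (norm2_le_of_mixing _ _ _ mix sfi fi0) => //.
  apply: le_trans (norm2_kernel_pow_le n muP sfi) _.
  rewrite (ae_eq_norm2 sgi.1 (mq _ sfi.1))//.
  apply: filterS gE => x /(_ Logic.I) ->; rewrite /kernel_op /Cintegral.
  by case: (f x).
Qed.

End generator_bounds.

Theorem theorem4 (R : realType) (d : measure_display) (S : measurableType d)
    (hS : standard_borel R S) (mu : probability S R)
    (eps : R) (eps_gt0 : 0 < eps) (eps_lt : eps < 1 / 2) :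
  (forall (P : R -> R.-pker S ~> S),
     markov_transition P ->
     (forall t : R, 0 <= t -> invariant_measure mu (P t)) ->
     strongly_continuous mu P ->
     let gamma := singular_value_gap mu (generator mu P) in
     (forall t : R, 0 < t -> (mix_dist mu (P t) <= eps%:E)%E ->
        (((1 - Num.sqrt (2 * eps)) / t)%:E <= gamma)%E) /\
     ((1 - Num.sqrt (2 * eps))%:E / gamma <= mixing_time mu P eps)%E)
  /\
  (forall (P : R.-pker S ~> S),
     invariant_measure mu P ->
     let gamma := singular_value_gap mu (discrete_generator mu P) in
     (forall t : nat, (0 < t)%N -> (mix_dist mu (kernel_pow P t) <= eps%:E)%E ->
        (((1 - Num.sqrt (2 * eps)) / t%:R)%:E <= gamma)%E) /\
     ((1 - Num.sqrt (2 * eps))%:E / gamma <= discrete_mixing_time mu P eps)%E).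
Proof.
have c0 : 0 < 1 - Num.sqrt (2 * eps).
  rewrite subr_gt0 -[ltRHS]sqrtr1 ltr_sqrt// mulrC -ltr_pdivlMr//.
split=> [P PP muP _ gamma|P muP gamma]; split.
- move=> t t0 mix.
  apply: (gap_ge c0 (ltW t0) _).1 => // f g fg f0.
  by apply: generator_bound fg f0 (ltW c0) => //; exact: ltW.
- apply: le_ereal_inf_tmp => _ [t [t0 mix] <-].
  apply: (gap_ge c0 t0 _).2 => f g fg f0.
  exact: generator_bound fg f0 (ltW c0).
- move=> t t0 mix.
  apply: (gap_ge c0 (ler0n R t) _).1; last by rewrite ltr0n.
  move=> f g fg f0; exact: discrete_generator_bound fg f0 (ltW c0).
- apply: le_ereal_inf_tmp => _ [n mix <-].
  apply: (gap_ge c0 (ler0n R n) _).2 => f g fg f0.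
  exact: discrete_generator_bound fg f0 (ltW c0).
Qed.
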